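(* Let $n\ge 1$ and $d\ge 1$ be integers, let $f=\sum_{I\subseteq\{1,\dots,n\},\,|I|=d}f_I x^I$ be a square-free (multilinear) homogeneous polynomial of degree $d$ with real coefficients $f_I$, where $x^I:=\prod_{i\in I}x_i$, and let $r\ge d$ be an integer. Then $$f_{\Delta(n,r)}-f_{\min}^{(r-d)}\le\left(\frac{r^d}{r^{\underline{d}}}-1\right)\left(\overline{f}-\underline{f}\right).$$
   Context: For an integer $d\ge 0$, $t^{\underline{d}}:=t(t-1)(t-2)\cdots(t-d+1)$ denotes the falling factorial. The standard simplex is $\Delta_n:=\{x\in\mathbb{R}^n: x_i\ge 0 \text{ for all } i,\ \sum_{i=1}^n x_i=1\}$. Put $\underline{f}:=\min_{x\in\Delta_n}f(x)$ and $\overline{f}:=\max_{x\in\Delta_n}f(x)$. For an integer $r\ge 1$, the regular grid is $\Delta(n,r):=\{x\in\Delta_n: rx\in\mathbb{N}^n\}$, where $\mathbb{N}^n$ is the set of nonnegative integer vectors, and $f_{\Delta(n,r)}:=\min_{x\in\Delta(n,r)}f(x)$. For a real homogeneous polynomial $f$ of degree $d$ in $x_1,\dots,x_n$ and an integer $r\ge d$, the quantity $f_{\min}^{(r-d)}$ is the maximum of all real $\lambda$ such that the polynomial $\left(\sum_{i=1}^n x_i\right)^{r-d}\left(f-\lambda\left(\sum_{i=1}^n x_i\right)^d\right)$ has only nonnegative coefficients. *)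

(* Defs.v *)
From mathcomp Require Import all_boot all_order all_algebra.
From mathcomp Require Import mpoly.
From mathcomp Require Import classical_sets reals.

Set Implicit Arguments.
Unset Strict Implicit.
Unset Printing Implicit Defensive.

Import Order.TTheory GRing.Theory Num.Theory.

Local Open Scope ring_scope.
Local Open Scope classical_set_scope.

(* The value is the attained extremum, i.e. the unique least (greatest) element
   of [A]; it is a junk value (0) when [A] has none. *)
Definition set_min (R : realType) (A : set R) : R := xget 0 (A `&` lbound A).
Definition set_max (R : realType) (A : set R) : R := xget 0 (A `&` ubound A).

Definition simplex (R : realType) (n : nat) : set ('I_n -> R) :=
  [set x | (forall i, 0 <= x i) /\ \sum_i x i = 1].

Definition grid (R : realType) (n r : nat) : set ('I_n -> R) :=
  [set x | simplex x /\ forall i, r%:R * x i \is a Num.nat].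

Definition min_on (R : realType) (n : nat) (f : {mpoly R[n]})
  (A : set ('I_n -> R)) : R := set_min [set f.@[x] | x in A].

Definition max_on (R : realType) (n : nat) (f : {mpoly R[n]})
  (A : set ('I_n -> R)) : R := set_max [set f.@[x] | x in A].

Definition sum_vars (R : realType) (n : nat) : {mpoly R[n]} := \sum_(i < n) 'X_i.

(* [polya_bound d k f] is $f_{\min}^{(k)}$ for a form [f] of degree [d]; the
   degree is an explicit argument because the zero form has every degree. *)
Definition polya_bound (R : realType) (n d k : nat) (f : {mpoly R[n]}) : R :=
  set_max [set l : R | forall m : 'X_{1..n},
    0 <= (sum_vars R n ^+ k * (f - l *: sum_vars R n ^+ d))@_m].

Definition squarefree_form (R : realType) (n d : nat) (c : {set 'I_n} -> R) :
  {mpoly R[n]} :=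
  \sum_(I : {set 'I_n} | #|I| == d) c I *: \prod_(i in I) 'X_i.

(* Main.v *)
(* Write S for the sum of the variables and k = r - d.  For |m| = r, the
   coefficient of S^k x^I at x^m is k!/m! times the product of the falling
   factorials of the exponents m_i of order 1, that is k!/m! m^I: for
   square-free forms, falling powers and ordinary powers agree.  Hence
   S^k (f - l S^d) has coefficient (k! f(m) - l r!)/m! at x^m, and by
   homogeneity f_min^(r-d) = (r^d / r^{\underline d}) f_{Delta(n,r)} exactly.
   The left-hand side is thus (r^d / r^{\underline d} - 1) (- f_{Delta(n,r)}),
   which is bounded using f_{Delta(n,r)} >= min f and max f >= 0; the latter
   holds for d >= 2 because f vanishes at the vertices, and for d = 1 both
   sides are 0. *)
Require Import Defs.
From mathcomp Require Import all_boot all_order all_algebra.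
From mathcomp Require Import mpoly.
From mathcomp Require Import classical_sets reals.
From mathcomp Require Import boolp topology normedtype derive.

Set Implicit Arguments.
Unset Strict Implicit.
Unset Printing Implicit Defensive.

Import Order.TTheory GRing.Theory Num.Theory numFieldNormedType.Exports.

Local Open Scope ring_scope.

(** * Factorials and multinomial coefficients *)

Lemma ffact_leq_exp n d : (n ^_ d <= n ^ d)%N.
Proof.
by elim: d => // d IHd; rewrite ffactnSr expnSr leq_mul // leq_subr.
Qed.

(** The multi-index factorial m!, the denominator of multinomial coefficients. The coefficient
    identities below multiply by it, which keeps them free of division. *)
Definition mfact n (m : 'X_{1..n}) : nat := (\prod_i (m i)`!)%N.

Lemma mfact_mulU n (m : 'X_{1..n}) (i : 'I_n) : m i != 0%N ->
  (mfact m = mfact (m - U_(i))%MM * m i)%N.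
Proof.
rewrite -lt0n => mi_gt0; rewrite /mfact (bigD1 i) //= [in RHS](bigD1 i) //=.
rewrite mnmBE mnm1E eqxx subn1 [RHS]mulnAC; congr (_ * _)%N.
  by case: (m i) mi_gt0 => // k _; rewrite factS mulnC.
apply: eq_bigr => j ne_ji.
by rewrite mnmBE mnm1E eq_sym (negbTE ne_ji) subn0.
Qed.

Lemma mesym1_le n (I : {set 'I_n}) (m : 'X_{1..n}) :
  (mesym1 I <= m)%MM = [forall (i | i \in I), (0 < m i)%N].
Proof.
apply/mnm_lepP/forall_inP => [le_m i iI|m_gt0 i].
  by have := le_m i; rewrite mnmE iI.
by rewrite mnmE; case: (boolP (i \in I)) => // /m_gt0.
Qed.

Lemma mfact_mul_mesym1 n (I : {set 'I_n}) (m : 'X_{1..n}) :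
  (mesym1 I <= m)%MM ->
  (mfact m = mfact (m - mesym1 I)%MM * \prod_(i in I) m i)%N.
Proof.
rewrite mesym1_le => /forall_inP m_gt0.
rewrite /mfact [X in (_ = _ * X)%N]big_mkcond -big_split /=.
apply: eq_bigr => i _; rewrite mnmBE mnmE.
case: (boolP (i \in I)) => [/m_gt0|_]; last by rewrite subn0 muln1.
by rewrite subn1; case: (m i) => // k _; rewrite factS mulnC.
Qed.

Lemma mcoeff_mulX n (R : nzRingType) (p : {mpoly R[n]}) (k m : 'X_{1..n}) :
  (p * 'X_[k])@_m = if (k <= m)%MM then p@_(m - k) else 0.
Proof.
case: ifPn => [le_km|nle_km]; first by rewrite -{1}(submK le_km) addmC mcoeffMX.
apply/eqP; rewrite mcoeff_eq0 (perm_mem (msuppMX p k)).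
by apply: contra nle_km => /mapP[m' _ ->]; apply: lem_addr.
Qed.

(** The multinomial theorem with denominators cleared. Splitting off one factor of the power gives a
    sum over i with weights m_i, and these add up to the degree k + 1. *)
Lemma mcoeff_sum_vars_exp (R : realType) n k (m : 'X_{1..n}) :
  (sum_vars R n ^+ k)@_m * (mfact m)%:R = (k`! * (mdeg m == k))%:R.
Proof.
elim: k m => [|k IHk] m.
  rewrite expr0 mcoeff1 mdeg_eq0 mul1n; case: eqP => [->|_]; last by rewrite mul0r.
  by rewrite mul1r /mfact big1 // => i _; rewrite mnm0E.
rewrite exprSr {2}/sum_vars mulr_sumr raddf_sum mulr_suml /=.
transitivity (\sum_i (k`! * (mdeg m == k.+1) * m i)%:R : R); last first.
  rewrite -natr_sum -big_distrr /= -mdegE factS.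
  by case: eqP => [->|_]; rewrite ?muln0 // !muln1 mulnC.
apply: eq_bigr => i _; rewrite mcoeff_mulX lep1mP.
case: eqP => [->|/eqP mi_neq0] /=; first by rewrite mul0r muln0.
rewrite (mfact_mulU mi_neq0) natrM mulrA IHk -natrM.
have /submK <- : (U_(i) <= m)%MM by rewrite lep1mP.
by rewrite mdegD mdeg1 addn1 eqSS addmK.
Qed.

(** Multiplication by x^I shifts exponents by the indicator [mesym1 I], and m! / (m - 1_I)! is the
    product of the m_i over I because each exponent drops by at most one. If some m_i with i in I is
    0, both sides vanish. *)
Lemma mcoeff_sum_vars_exp_mul_vars (R : realType) n k (I : {set 'I_n})
    (m : 'X_{1..n}) :
  (sum_vars R n ^+ k * \prod_(i in I) 'X_i)@_m * (mfact m)%:R =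
  (k`! * (mdeg m == k + #|I|)%N * \prod_(i in I) m i)%:R.
Proof.
have -> : \prod_(i in I) 'X_i = 'X_[mesym1 I] :> {mpoly R[n]}.
  rewrite mprodXE; congr 'X_[_]; apply/mnmP => i.
  rewrite mnmE mnm_sumE big_mkcond (bigD1 i) //= mnm1E eqxx.
  rewrite big1 ?addn0; first by case: (i \in I).
  by move=> j ne_ji; rewrite mnm1E (negbTE ne_ji) if_same.
rewrite mcoeff_mulX; case: ifPn => [le_Im|].
  rewrite (mfact_mul_mesym1 le_Im) natrM mulrA mcoeff_sum_vars_exp -natrM.
  by rewrite -(eqn_add2r #|I|) -{1}(mdeg_mesym1 I) -mdegD submK.
rewrite mesym1_le => /forall_inPn[i iI]; rewrite -leqNgt leqn0 => /eqP mi0.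
by rewrite mul0r (bigD1 i) //= mi0 mul0n muln0.
Qed.

(** * Values of square-free forms and the coefficient condition *)

Lemma meval_squarefree_form (R : realType) n d (c : {set 'I_n} -> R) x :
  (squarefree_form d c).@[x] = \sum_(I : {set 'I_n} | #|I| == d) c I * \prod_(i in I) x i.
Proof.
rewrite /squarefree_form raddf_sum /=; apply: eq_bigr => I _.
by rewrite mevalZ rmorph_prod /=; congr (_ * _); apply: eq_bigr => i _; rewrite mevalXU.
Qed.

Lemma meval_squarefree_form_scale (R : realType) n d (c : {set 'I_n} -> R) a x :
  (squarefree_form d c).@[fun i => a * x i] = a ^+ d * (squarefree_form d c).@[x].
Proof.
rewrite !meval_squarefree_form mulr_sumr; apply: eq_bigr => I /eqP <-.
by rewrite big_split /= prodr_const mulrCA.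
Qed.

Lemma mcoeff_sum_vars_exp_mul_squarefree_form (R : realType) n d k
    (c : {set 'I_n} -> R) (m : 'X_{1..n}) :
  (sum_vars R n ^+ k * squarefree_form d c)@_m * (mfact m)%:R =
  (k`! * (mdeg m == k + d)%N)%:R * (squarefree_form d c).@[fun i => (m i)%:R].
Proof.
rewrite meval_squarefree_form /squarefree_form !mulr_sumr raddf_sum mulr_suml.
apply: eq_bigr => I /eqP <- /=.
rewrite -scalerAr mcoeffZ -mulrA mcoeff_sum_vars_exp_mul_vars natrM mulrCA.
by rewrite natr_prod.
Qed.

(** Multiplying a coefficient by m! > 0 keeps its sign, and coefficients in degrees other than k + d
    are 0. *)
Lemma polya_nonneg (R : realType) n d k (c : {set 'I_n} -> R) (l : R) :
  (forall m : 'X_{1..n}, 0 <=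
    (sum_vars R n ^+ k * (squarefree_form d c - l *: sum_vars R n ^+ d))@_m) <->
  (forall m : 'X_{1..n}, mdeg m = (k + d)%N ->
    l * (k + d)`!%:R <= k`!%:R * (squarefree_form d c).@[fun i => (m i)%:R]).
Proof.
have coeffE m :
    (sum_vars R n ^+ k * (squarefree_form d c - l *: sum_vars R n ^+ d))@_m
      * (mfact m)%:R =
    (mdeg m == k + d)%N%:R *
      (k`!%:R * (squarefree_form d c).@[fun i => (m i)%:R] - l * (k + d)`!%:R).
  rewrite mulrBr -scalerAr -exprD mcoeffB mcoeffZ mulrBl -mulrA.
  rewrite mcoeff_sum_vars_exp mcoeff_sum_vars_exp_mul_squarefree_form.
  by case: eqP; rewrite ?muln1 ?mul1r // !muln0 !mul0r mulr0 subr0.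
have mfact_gt0 (m : 'X_{1..n}) : 0 < (mfact m)%:R :> R.
  by rewrite ltr0n; apply: prodn_gt0 => i; apply: fact_gt0.
split=> [coeff_ge0 m mdegm|le_l m].
  by have := mulr_ge0 (coeff_ge0 m) (ltW (mfact_gt0 m));
    rewrite coeffE mdegm eqxx mul1r subr_ge0.
rewrite -(pmulr_lge0 _ (mfact_gt0 m)) coeffE.
by case: eqP => [/le_l|]; rewrite ?mul0r // mul1r subr_ge0.
Qed.

(** * Attained extrema *)

Local Open Scope classical_set_scope.

(** Antisymmetry leaves [a] as the only element that [xget] can choose, so its default 0 is not
    returned. *)
Lemma set_minE (R : realType) (A : set R) a :
  A a -> lbound A a -> set_min A = a.
Proof.
move=> Aa lba; apply: xget_unique => [|b [Ab lbb]]; first by split.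
by apply/le_anti; rewrite lba // lbb.
Qed.

Lemma set_maxE (R : realType) (A : set R) a :
  A a -> ubound A a -> set_max A = a.
Proof.
move=> Aa uba; apply: xget_unique => [|b [Ab ubb]]; first by split.
by apply/le_anti; rewrite uba // ubb.
Qed.

Lemma min_onP (R : realType) n (f : {mpoly R[n]}) A x : A x ->
  (forall y, A y -> f.@[x] <= f.@[y]) -> min_on f A = f.@[x].
Proof. by move=> Ax fx; apply: set_minE => [|_ [y Ay <-]]; [exists x|apply: fx]. Qed.

Lemma max_onP (R : realType) n (f : {mpoly R[n]}) A x : A x ->
  (forall y, A y -> f.@[y] <= f.@[x]) -> max_on f A = f.@[x].
Proof. by move=> Ax fx; apply: set_maxE => [|_ [y Ay <-]]; [exists x|apply: fx]. Qed.

(** * Compactness of the simplex and extrema on it *)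

Section Simplex.
Variables (R : realType) (n : nat).

Let T : topologicalType := prod_topology (fun _ : 'I_n => R).

Lemma coord_fun_continuous i : continuous (fun x : T => x i : R).
Proof. exact: (@proj_continuous _ (fun _ : 'I_n => (R : topologicalType)) i). Qed.

Lemma sum_fun_continuous I (r : seq I) (P : pred I) (F : I -> T -> R) :
  (forall i, P i -> continuous (F i)) ->
  continuous (fun x : T => \sum_(i <- r | P i) F i x).
Proof. by apply: continuous_big; exact: add_continuous. Qed.

Lemma prod_fun_continuous I (r : seq I) (P : pred I) (F : I -> T -> R) :
  (forall i, P i -> continuous (F i)) ->
  continuous (fun x : T => \prod_(i <- r | P i) F i x).
Proof. by apply: continuous_big; exact: mul_continuous. Qed.

Lemma meval_continuous (f : {mpoly R[n]}) : continuous (fun x : T => f.@[x]).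
Proof.
under eq_fun do rewrite mevalE.
apply: sum_fun_continuous => m _ x.
apply: continuousM; first exact: cst_continuous.
apply: prod_fun_continuous => i _.
(* A power is written as a constant product over ['I_(m i)], so that continuity of finite products
   applies again. *)
under eq_fun do rewrite -[m i]card_ord -prodr_const.
by apply: prod_fun_continuous => _ _; exact: coord_fun_continuous.
Qed.

(** The simplex is a closed subset of the cube [0,1]^n, which is compact by Tychonoff. *)
Lemma simplex_compact : compact (@simplex R n : set T).
Proof.
have -> : @simplex R n =
    [set x : T | forall i, x i \in `[0, 1]%R] `&`
    ((fun x : T => \sum_i x i) @^-1` [set y | y = 1]).
  apply/seteqP; split=> [x [x_ge0 sum_x]|x [x_itv sum_x]]; split => // i.
    rewrite in_itv /= x_ge0 -sum_x (bigD1 i) //= lerDl.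
    by apply: sumr_ge0.
  by have := x_itv i; rewrite in_itv => /andP[].
apply: compact_closedI.
  apply: (@tychonoff _ (fun _ => R) (fun _ => `[0, 1]%classic)) => i.
  exact: segment_compact.
apply: closed_comp; last exact: closed_eq.
move=> x _; apply: sum_fun_continuous => i _; exact: coord_fun_continuous.
Qed.

Lemma simplex_vertex (i0 : 'I_n) : @simplex R n (fun i => (i == i0)%:R).
Proof.
split=> [i|]; first exact: ler0n.
by rewrite (bigD1 i0) //= eqxx big1 ?addr0 // => i /negbTE ->.
Qed.

Lemma simplex_nonempty : (0 < n)%N -> (@simplex R n : set T) !=set0.
Proof. by move=> n_gt0; eexists; apply: (simplex_vertex (Ordinal n_gt0)). Qed.

(** By the extreme value theorem the minimum is attained, so [min_on] is a true minimum here. *)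
Lemma min_on_simplex (f : {mpoly R[n]}) : (0 < n)%N ->
  forall x, simplex x -> min_on f (@simplex R n) <= f.@[x].
Proof.
move=> n_gt0 y Sy.
have [x /set_mem Sx x_min] := compact_EVT_min
  (simplex_nonempty n_gt0) simplex_compact
  (continuous_subspaceT (@meval_continuous f)).
by rewrite (min_onP Sx) => [|z Sz]; apply: x_min; apply: mem_set.
Qed.

Lemma max_on_simplex (f : {mpoly R[n]}) : (0 < n)%N ->
  forall x, simplex x -> f.@[x] <= max_on f (@simplex R n).
Proof.
move=> n_gt0 y Sy.
have [x /set_mem Sx x_max] := compact_EVT_max
  (simplex_nonempty n_gt0) simplex_compact
  (continuous_subspaceT (@meval_continuous f)).
by rewrite (max_onP Sx) => [|z Sz]; apply: x_max; apply: mem_set.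
Qed.

End Simplex.

(** * Grid points as scaled multi-indices of degree r *)

Lemma gridP (R : realType) n r (x : 'I_n -> R) : (0 < r)%N ->
  grid r x <->
  exists2 m : 'X_{1..n}, mdeg m = r & x = (fun i => r%:R^-1 * (m i)%:R).
Proof.
move=> r_gt0; have r_neq0 : r%:R != 0 :> R by rewrite pnatr_eq0 -lt0n.
split=> [[[_ sum_x] nat_x]|[m mdegm ->]].
  have m_eq i : (Num.truncn (r%:R * x i))%:R = r%:R * x i :> R by exact: truncnK.
  exists [multinom Num.truncn (r%:R * x i) | i < n].
    apply/eqP; rewrite mdegE -(eqr_nat R) natr_sum.
    under eq_bigr do rewrite mnmE m_eq.
    by rewrite -mulr_sumr sum_x mulr1.
  by apply/funext => i; rewrite mnmE m_eq mulKf.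
split=> [|i]; last by rewrite mulVKf.
split=> [i|]; first by rewrite mulr_ge0 ?invr_ge0 ?ler0n.
by rewrite -mulr_sumr -natr_sum -mdegE mdegm mulVf.
Qed.

Lemma min_on_grid (R : realType) n r (f : {mpoly R[n]}) :
  (0 < n)%N -> (0 < r)%N ->
  exists2 x, grid r x & (forall y, grid r y -> f.@[x] <= f.@[y]).
Proof.
move=> n_gt0 r_gt0; pose pt (m : 'X_{1..n}) i : R := r%:R^-1 * (m i)%:R.
have mdegP (m : 'X_{1..n}) : mdeg m = r -> (mdeg m < r.+1)%N by move=> ->.
have mdeg0 : mdeg (U_(Ordinal n_gt0) *+ r)%MM = r by rewrite mdegMn mdeg1 mul1n.
(* Multi-indices of degree below r + 1 form a finite type, so a minimizer exists; the vertex r e_0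
   shows that degree r occurs. *)
case: (@arg_minP _ _ _ (BMultinom (mdegP _ mdeg0)) (fun m => mdeg m == r)
  (fun m => f.@[pt m])) => [|m /eqP mdegm m_min]; first exact/eqP.
exists (pt m) => [|_ /gridP[//|m' mdegm' ->]]; first by apply/gridP => //; exists m.
by apply: (m_min (BMultinom (mdegP _ mdegm'))); apply/eqP.
Qed.

(** * The exact value of the coefficient bound, and the inequality *)

Lemma polya_bound_squarefree_form (R : realType) n d k (c : {set 'I_n} -> R) :
  let r := (k + d)%N in let f := squarefree_form d c in
  (0 < n)%N -> (0 < r)%N ->
  polya_bound d k f = (r ^ d)%:R / (r ^_ d)%:R * min_on f (@grid R n r).
Proof.
move=> r f n_gt0 r_gt0; have [x grid_x x_min] := min_on_grid f n_gt0 r_gt0.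
rewrite (min_onP grid_x x_min).
have r_neq0 : r%:R != 0 :> R by rewrite pnatr_eq0 -lt0n.
have ffact_neq0 : (r ^_ d)%:R != 0 :> R.
  by rewrite pnatr_eq0 -lt0n ffact_gt0 leq_addl.
have kfact_gt0 : 0 < k`!%:R :> R by rewrite ltr0n fact_gt0.
(* The admissible l are exactly the lower bounds of C f on the grid, with C = r^d / r^{\underline
   d}; the greatest one is C times the grid minimum, as C >= 0. *)
have admissible (l : R) :
    (forall m : 'X_{1..n}, 0 <=
       (sum_vars R n ^+ k * (f - l *: sum_vars R n ^+ d))@_m) <->
    (forall y, grid r y -> l <= (r ^ d)%:R / (r ^_ d)%:R * f.@[y]).
  have leE (m : 'X_{1..n}) : (l * r`!%:R <= k`!%:R * f.@[fun i => (m i)%:R]) =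
      (l <= (r ^ d)%:R / (r ^_ d)%:R * f.@[fun i => r%:R^-1 * (m i)%:R]).
    (* Homogeneity turns r^d f(m/r) into f(m), and r! = r^{\underline d} k! allows cancelling k!. *)
    rewrite meval_squarefree_form_scale exprVn natrX mulrAC mulVKf ?expf_neq0 //.
    rewrite ler_pdivlMr ?lt0r ?ffact_neq0 ?ler0n // -(ffact_fact (leq_addl k d)).
    by rewrite addnK natrM mulrA [leRHS]mulrC ler_pM2r.
  rewrite polya_nonneg; split=> [le_l y /gridP[//|m mdegm ->]|le_l m mdegm].
    by rewrite -leE le_l.
  by rewrite leE; apply: le_l; apply/gridP => //; exists m.
have C_ge0 : 0 <= (r ^ d)%:R / (r ^_ d)%:R :> R by rewrite divr_ge0 ?ler0n.
apply: set_maxE => [|l /= /admissible]; last exact.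
by apply/admissible => y /x_min; apply: ler_wpM2l.
Qed.

(** A vertex has a single nonzero coordinate, while every monomial involves at least two
    variables. *)
Lemma max_on_squarefree_form_ge0 (R : realType) n d (c : {set 'I_n} -> R) :
  (0 < n)%N -> (1 < d)%N -> 0 <= max_on (squarefree_form d c) (@simplex R n).
Proof.
move=> n_gt0 d_gt1; pose i0 := Ordinal n_gt0.
apply: le_trans (max_on_simplex _ n_gt0 (simplex_vertex R i0)).
rewrite meval_squarefree_form big1 // => I /eqP card_I.
have /subsetPn[i iI] : ~~ (I \subset [set i0]%SET).
  by apply: contraL d_gt1 => /subset_leq_card; rewrite cards1 card_I -leqNgt.
by rewrite inE => /negbTE i_neq; rewrite (bigD1 i) //= i_neq mul0r mulr0.
Qed.

Theorem theorem6 (R : realType) (n d r : nat) (fI : {set 'I_n} -> R)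
    (f : {mpoly R[n]}) (n_ge1 : (1 <= n)%N) (d_ge1 : (1 <= d)%N)
    (d_le_r : (d <= r)%N) (f_def : f = squarefree_form d fI) :
  min_on f (@grid R n r) - polya_bound d (r - d) f
    <= ((r ^ d)%:R / (r ^_ d)%:R - 1)
       * (max_on f (@simplex R n) - min_on f (@simplex R n)).
Proof.
have r_gt0 : (0 < r)%N by apply: leq_trans d_ge1 d_le_r.
rewrite f_def polya_bound_squarefree_form ?subnK // -f_def.
set C := _ / _.
(* The left side becomes (C - 1) times minus the grid minimum. *)
rewrite -{1}[min_on f _]mul1r -mulrBl -opprB mulNr -mulrN.
(* A linear form may have a negative maximum, but for d = 1 the factor C - 1 is 0. *)
have [d_le1|d_gt1] := leqP d 1.
  have d1 : d = 1%N by apply/eqP; rewrite eqn_leq d_le1.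
  by rewrite /C d1 expn1 ffactn1 divff ?subrr ?mul0r // pnatr_eq0 -lt0n.
apply: ler_wpM2l.
  rewrite subr_ge0 ler_pdivlMr ?ltr0n ?ffact_gt0 // mul1r ler_nat.
  exact: ffact_leq_exp.
have [x grid_x /(min_onP grid_x) ->] := min_on_grid f n_ge1 r_gt0.
have := min_on_simplex f n_ge1 (proj1 grid_x).
have := max_on_squarefree_form_ge0 fI n_ge1 d_gt1.
rewrite -f_def => max_ge0 min_le.
by rewrite -[leLHS]add0r lerD // lerN2.
Qed.
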